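(* Let $n\ge3$ and $A=A^\top\in\mathbb{R}^{n\times n}$. Assume that $A$ has only two distinct eigenvalues and the smaller one has multiplicity one. Then $q_A:\mathbb{S}^{n-1}\cap\operatorname{int}(\mathcal{L})\to\mathbb{R}$, $q_A(x)=\langle Ax,x\rangle$, is a spherically quasi-convex function if and only if the second order cone $\mathcal{L}$ contains an eigenvector of $A$ corresponding to the smaller eigenvalue.
   Context: $\mathcal{L}=\{x=(x_1,\dots,x_n)^\top\in\mathbb{R}^n: x_1\ge\sqrt{x_2^2+\dots+x_n^2}\}$ is the second order (Lorentz) cone and $\mathbb{S}^{n-1}=\{x\in\mathbb{R}^n:\|x\|=1\}$. For $x,y\in\mathbb{S}^{n-1}$ with $y\ne\pm x$ the minimal geodesic from $x$ to $y$ is the constant-speed parametrization $[0,1]\to\mathbb{S}^{n-1}$ of the shorter great-circle arc from $x$ to $y$. A function $f:\mathcal{S}\to\mathbb{R}$ on $\mathcal{S}=\mathbb{S}^{n-1}\cap\operatorname{int}(\mathcal{L})$ is spherically quasi-convex if for every minimal geodesic segment $\gamma:[0,1]\to\mathcal{S}$ the composition $f\circ\gamma$ is quasi-convex in the usual sense. *)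

(* Defs.v *)
From mathcomp Require Import all_boot all_order all_algebra.
From mathcomp Require Import all_classical all_reals all_analysis.
Set Implicit Arguments.
Unset Strict Implicit.
Unset Printing Implicit Defensive.
Import Order.TTheory GRing.Theory Num.Theory.
Import numFieldNormedType.Exports.
Local Open Scope classical_set_scope.
Local Open Scope ring_scope.

(* The library norm `|x| on matrices is the max norm, so the Euclidean
   structure is given explicitly; the topology (hence the interior) is the
   same for both norms. *)
Definition dotprod (R : realType) (n : nat) (x y : 'cV[R]_n) : R :=
  \sum_(i < n) x i 0 * y i 0.

Definition norm2 (R : realType) (n : nat) (x : 'cV[R]_n) : R :=
  Num.sqrt (dotprod x x).

Definition sphere (R : realType) (n : nat) : set 'cV[R]_n :=
  [set x | norm2 x = 1].
Arguments sphere : clear implicits.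

(* In R^(n+1): the coordinate x_1 is the one of index ord0, and the remaining
   ones are those of index lift ord0 i. *)
Definition lorentz (R : realType) (n : nat) : set 'cV[R]_n.+1 :=
  [set x | Num.sqrt (\sum_(i < n) x (lift ord0 i) 0 ^+ 2) <= x ord0 0].
Arguments lorentz : clear implicits.

Definition lorentz_sphere (R : realType) (n : nat) : set 'cV[R]_n.+1 :=
  sphere R n.+1 `&` interior (lorentz R n).
Arguments lorentz_sphere : clear implicits.

(* Minimal geodesic from x to y, for unit vectors x, y with y <> x and y <> - x:
   it starts at x with unit direction (y - <x,y> x) / sqrt (1 - <x,y>^2),
   tangent to the sphere at x, and has constant speed equal to the spherical
   distance acos <x,y>, so that it reaches y at time 1. *)
Definition geodesic (R : realType) (n : nat) (x y : 'cV[R]_n) (t : R) :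
    'cV[R]_n :=
  let c := dotprod x y in
  let d := acos c in
  cos (t * d) *: x
  + (sin (t * d) / Num.sqrt (1 - c ^+ 2)) *: (y - c *: x).

Definition quasiconvex_on (R : realType) (D : set R) (phi : R -> R) : Prop :=
  forall s t p : R, D s -> D t -> 0 <= p <= 1 ->
    phi ((1 - p) * s + p * t) <= Num.max (phi s) (phi t).

(* Only the values of f on C matter. *)
Definition spherically_quasiconvex (R : realType) (n : nat)
    (C : set 'cV[R]_n) (f : 'cV[R]_n -> R) : Prop :=
  forall x y : 'cV[R]_n, sphere R n x -> sphere R n y -> y <> x -> y <> - x ->
    geodesic x y @` `[0, 1] `<=` C ->
    quasiconvex_on `[0, 1] (f \o geodesic x y).

Definition qform (R : realType) (n : nat) (A : 'M[R]_n) (x : 'cV[R]_n) : R :=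
  dotprod (A *m x) x.

Definition is_eigenvector (R : realType) (n : nat) (A : 'M[R]_n) (a : R)
    (v : 'cV[R]_n) : Prop :=
  v <> 0 /\ A *m v = a *: v.

(* Main.v *)
Require Import Defs.
From mathcomp Require Import all_boot all_order all_algebra.
From mathcomp Require Import all_classical all_reals all_analysis.
From mathcomp Require Import complex ring lra.

(** Write v for an eigenvector of the smaller eigenvalue lam.  By the spectral
theorem A is a scalar matrix mu minus a rank one matrix, so that
<v,v> q_A(x) = mu <v,v> <x,x> - (mu - lam) <v,x>^2
([qform_simple_eigenvalue]).  On the unit sphere q_A is therefore a decreasing
function of <v,x>^2, and the question is when |<v,x>| is quasi-concave along
the geodesics of the open cone.

If v is in the cone, self-duality of the cone ([lorentz_dotprod_ge0]) makes
<v,x> nonnegative there.  Along a geodesic, gamma(p) is a combination of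
gamma(s) and gamma(t) with nonnegative coefficients of sum at least 1
([geodesic_interpolation] and [sinD_le]), so <v,gamma(p)> is at least the
smaller of <v,gamma(s)> and <v,gamma(t)> ([geodesic_dotprod_min]).

If neither v nor -v is in the cone, the hyperplane orthogonal to v meets the
interior of the cone, at some z.  Two unit vectors proportional to z + e v and
z - e v, for a small e > 0, have opposite products with v and hence the same
value of q_A, less than mu; the midpoint of the geodesic that joins them is
orthogonal to v, and there q_A is equal to mu
([not_quasiconvex_of_outside_cone]).  All of this takes place in the plane
spanned by the axis of the cone and v, where the cone reads |b| < a in suitable
coordinates ([lorentz_plane]). *)

Import Order.TTheory GRing.Theory Num.Theory.
Import numFieldNormedType.Exports.
Set Implicit Arguments.
Unset Strict Implicit.
Unset Printing Implicit Defensive.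
Local Open Scope ring_scope.

(** * Symmetric matrices with a simple eigenvalue *)

Lemma char_poly_conj (F : fieldType) (n : nat) (P D : 'M[F]_n) :
  P \in unitmx -> char_poly (invmx P *m D *m P) = char_poly D.
Proof.
move=> uP; rewrite /char_poly.
have -> : char_poly_mx (invmx P *m D *m P) =
    map_mx polyC (invmx P) *m char_poly_mx D *m map_mx polyC P.
  rewrite /char_poly_mx mulmxBr mulmxBl -!map_mxM /=; congr (_ - _).
  by rewrite mul_mx_scalar -scalemxAl -map_mxM mulVmx// map_mx1 scalemx1.
rewrite !det_mulmx mulrC mulrA -det_mulmx -map_mxM mulmxV// map_mx1.
by rewrite det1 mul1r.
Qed.

(** The spectral theorem for hermitian matrices is applied to A seen as a
complex matrix.  Its diagonal is real, so the factorization of the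
characteristic polynomial descends to R; the diagonalizing matrix stays
complex, which is enough to read off polynomial identities between the
entries of A. *)
Lemma real_sym_diagonalizable (R : realType) (n : nat) (A : 'M[R]_n) :
  A^T = A ->
  exists (r : 'I_n -> R) (P : 'M[complex R]_n),
    [/\ P \in unitmx,
        map_mx (real_complex R) A =
          invmx P *m diag_mx (\row_i (r i)%:C%C) *m P
      & char_poly A = \prod_(i < n) ('X - (r i)%:P)].
Proof.
move=> hA; set B := map_mx _ A.
have hB : B \is hermsymmx.
  apply/is_hermitianmxP; rewrite expr0 scale1r.
  apply/matrixP => i j; rewrite !mxE /= -[in LHS]hA mxE.
  by rewrite /Num.conj /= oppr0.
have := hermitian_spectral_diag_real hB.
move/mxOverP => hreal.
have /orthomx_spectralP hsp := hermitian_normalmx hB.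
pose r i := complex.Re (spectral_diag B 0 i).
have hr : spectral_diag B = \row_i (r i)%:C%C.
  by apply/rowP => i; rewrite mxE /r RRe_real.
exists r, (spectralmx B); split.
- exact: spectral_unit.
- by rewrite -hr.
apply: (map_poly_inj (real_complex R)).
rewrite map_char_poly -/B hsp char_poly_conj ?spectral_unit//.
rewrite char_poly_trig ?diag_mx_is_trig// rmorph_prod /=.
apply: eq_bigr => i _.
by rewrite rmorphB /= map_polyX map_polyC /= hr !mxE eqxx mulr1n.
Qed.

(** The matrix mu - A has rank one, since in a diagonal form of A the value lam
occurs exactly once and mu everywhere else.  Rank one is stated as the
vanishing of the 2 x 2 minors because this form is insensitive to the field:
it is proved over the complex numbers and used over the reals. *)
Lemma simple_eigenvalue_minors (R : realType) (n : nat) (A : 'M[R]_n)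
    (lam mu : R) :
  A^T = A -> (forall a, eigenvalue A a -> a = lam \/ a = mu) ->
  mup lam (char_poly A) = 1%N ->
  forall i j k l,
  (mu%:M - A) i j * (mu%:M - A) k l = (mu%:M - A) i l * (mu%:M - A) k j.
Proof.
move=> hA heig hmult.
have [r [P [uP hAP hchar]]] := real_sym_diagonalizable hA.
have {}hchar : char_poly A = \prod_(a <- codom r) ('X - a%:P).
  by rewrite hchar big_image.
have hr i : r i = lam \/ r i = mu.
  by apply: heig; rewrite eigenvalue_root_char hchar root_prod_XsubC codom_f.
have /eqP/card1P[i0 hi0] : #|[pred i | r i == lam]| = 1%N.
  rewrite -[RHS]hmult hchar mu_prod_XsubC count_map.
  by rewrite cardE -size_filter /enum_mem filter_predT.
(* P^-1 (mu - D) P, where the only nonzero entry of mu - D is at i0. *)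
have hM i j : ((mu%:M - A) i j)%:C%C =
    (mu - lam)%:C%C * (invmx P i i0 * P i0 j).
  have -> : ((mu%:M - A) i j)%:C%C = map_mx (real_complex R) (mu%:M - A) i j.
    by rewrite [RHS]mxE.
  have -> : map_mx (real_complex R) (mu%:M - A) =
      invmx P *m diag_mx (\row_i (mu - r i)%:C%C) *m P.
    rewrite map_mxB hAP map_scalar_mx /=.
    have -> : \row_i (mu - r i)%:C%C = const_mx mu%:C%C - \row_i (r i)%:C%C.
      by apply/rowP => k; rewrite !mxE rmorphB.
    by rewrite raddfB /= diag_const_mx mulmxBr mulmxBl mul_mx_scalar
      -scalemxAl mulVmx// scalemx1.
  rewrite mul_mx_diag mxE (bigD1 i0)//= big1 ?addr0 => [|k hk].
    have := hi0 i0; rewrite !inE eqxx => /eqP <-.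
    by rewrite !mxE; ring.
  have := hi0 k; rewrite !inE (negPf hk) => /eqP hk'.
  by rewrite !mxE; case: (hr k) => // ->; rewrite subrr rmorph0 mulr0 mul0r.
move=> i j k l; apply: complexI.
by rewrite !rmorphM /= !hM; ring.
Qed.

(** * The Euclidean scalar product *)

Section DotProduct.
Variables (R : realType) (n : nat).
Implicit Types (x y z : 'cV[R]_n) (a : R).

Lemma dotprodC x y : dotprod x y = dotprod y x.
Proof. by apply: eq_bigr => i _; rewrite mulrC. Qed.

Lemma dotprodDr x y z : dotprod x (y + z) = dotprod x y + dotprod x z.
Proof. by rewrite -big_split; apply: eq_bigr => i _; rewrite mxE mulrDr. Qed.

Lemma dotprodZr a x y : dotprod x (a *: y) = a * dotprod x y.
Proof. by rewrite big_distrr; apply: eq_bigr => i _; rewrite mxE mulrCA. Qed.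

Lemma dotprodr0 x : dotprod x 0 = 0.
Proof. by rewrite -(scale0r x) dotprodZr mul0r. Qed.

Lemma dotprodNr x y : dotprod x (- y) = - dotprod x y.
Proof. by rewrite -scaleN1r dotprodZr mulN1r. Qed.

Lemma dotprodDl x y z : dotprod (x + y) z = dotprod x z + dotprod y z.
Proof. by rewrite dotprodC dotprodDr !(dotprodC z). Qed.

Lemma dotprodZl a x y : dotprod (a *: x) y = a * dotprod x y.
Proof. by rewrite dotprodC dotprodZr dotprodC. Qed.

Lemma dotprodNl x y : dotprod (- x) y = - dotprod x y.
Proof. by rewrite dotprodC dotprodNr dotprodC. Qed.

Definition dotprodE :=
  (dotprodDr, dotprodZr, dotprodNr, dotprodDl, dotprodZl, dotprodNl).

Lemma dotprod_ge0 x : 0 <= dotprod x x.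
Proof. by apply: sumr_ge0 => i _; rewrite -expr2 sqr_ge0. Qed.

Lemma dotprod_gt0 x : x <> 0 -> 0 < dotprod x x.
Proof.
move=> /eqP x0; rewrite lt0r dotprod_ge0 andbT; apply: contra x0.
rewrite psumr_eq0 => [/allP h|i _]; last by rewrite -expr2 sqr_ge0.
apply/eqP/colP => i; have := h i (mem_index_enum _).
by rewrite mxE mulf_eq0 orbb => /eqP.
Qed.

Lemma sphere_dotprod x : sphere R n x <-> dotprod x x = 1.
Proof.
rewrite /sphere /norm2 /=; split=> [h|->]; last exact: sqrtr1.
by rewrite -[LHS]sqr_sqrtr ?dotprod_ge0// h expr1n.
Qed.

Lemma cauchy_schwarz x y : dotprod x y ^+ 2 <= dotprod x x * dotprod y y.
Proof.
have [->|/eqP y0] := eqVneq y 0.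
  by rewrite !dotprodr0 mulr0 expr0n.
have hy := dotprod_gt0 y0.
have := dotprod_ge0 (dotprod y y *: x - dotprod x y *: y).
rewrite !dotprodE (dotprodC y x) => h.
rewrite -subr_ge0 -(pmulr_rge0 _ hy); apply: le_trans h _.
by rewrite le_eqVlt; apply/orP; left; apply/eqP; ring.
Qed.

(** This is what makes the geodesic from x to y nondegenerate: its length
is strictly between 0 and pi. *)
Lemma sphere_dotprod_lt1 x y : sphere R n x -> sphere R n y ->
  y <> x -> y <> - x -> -1 < dotprod x y < 1.
Proof.
move=> /sphere_dotprod hx /sphere_dotprod hy hyx hyNx.
have /dotprod_gt0 : y - x <> 0 by move/eqP; rewrite subr_eq0 => /eqP.
have /dotprod_gt0 : y + x <> 0 by move/eqP; rewrite addr_eq0 => /eqP.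
by rewrite !dotprodE hx hy (dotprodC y x) => h1 h2; apply/andP; split; lra.
Qed.

End DotProduct.

(** * The quadratic form of a matrix with a simple smaller eigenvalue *)

(** As mu - A is symmetric of rank one and v is an eigenvector of it for
mu - lam, it is (mu - lam) v v^T / <v,v>. *)
Lemma qform_simple_eigenvalue (R : realType) (n : nat) (A : 'M[R]_n)
    (lam mu : R) (v x : 'cV[R]_n) :
  A^T = A -> (forall a, eigenvalue A a -> a = lam \/ a = mu) ->
  mup lam (char_poly A) = 1%N -> lam < mu -> A *m v = lam *: v ->
  dotprod v v * qform A x =
  mu * dotprod v v * dotprod x x - (mu - lam) * dotprod v x ^+ 2.
Proof.
move=> hA heig hmult hlt hv.
have hminor := simple_eigenvalue_minors hA heig hmult.
set M := mu%:M - A in hminor.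
have hd : mu - lam != 0 by rewrite subr_eq0 gt_eqF.
have hMv : M *m v = (mu - lam) *: v.
  by rewrite mulmxBl mul_scalar_mx hv scalerBl.
have hMvE i : \sum_k M i k * v k 0 = (mu - lam) * v i 0.
  by move/colP/(_ i) : hMv; rewrite !mxE.
have hMsym i j : M i j = M j i.
  by rewrite /M !mxE -[in LHS]hA mxE eq_sym.
(* Evaluate <v, M v> M i j in two ways, moving the indices with the minors. *)
have hMij i j : M i j * dotprod v v = (mu - lam) * (v i 0 * v j 0).
  apply: (mulfI hd).
  transitivity (M i j * \sum_l v l 0 * \sum_k M l k * v k 0).
    rewrite mulrCA; congr (_ * _); rewrite /dotprod mulr_sumr.
    by apply: eq_bigr => l _; rewrite hMvE; ring.
  transitivity ((\sum_k M i k * v k 0) * \sum_l M j l * v l 0).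
    rewrite !mulr_sumr; apply: eq_bigr => l _.
    rewrite !mulr_sumr mulr_suml; apply: eq_bigr => k _.
    transitivity (M i j * M l k * (v l 0 * v k 0)); first by ring.
    by rewrite hminor (hMsym l j); ring.
  by rewrite !hMvE; ring.
have hMx : dotprod (M *m x) x = mu * dotprod x x - qform A x.
  by rewrite mulmxBl mul_scalar_mx !dotprodE.
suff: dotprod v v * dotprod (M *m x) x = (mu - lam) * dotprod v x ^+ 2.
  by rewrite hMx => <-; ring.
move: (dotprod v v) hMij => D hMij.
rewrite expr2 /dotprod mulrA !mulr_sumr; apply: eq_bigr => i _ /=.
rewrite mxE !mulr_suml mulr_sumr; apply: eq_bigr => j _ /=.
transitivity (M i j * D * (x i 0 * x j 0)); first by ring.
by rewrite hMij; ring.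
Qed.

(** * Minimal geodesics *)

Lemma sinD_le (R : realType) (a b : R) : 0 <= a <= pi -> 0 <= b <= pi ->
  sin (a + b) <= sin a + sin b.
Proof.
move=> /sin_ge0_pi ha /sin_ge0_pi hb.
by rewrite sinD lerD ?ler_piMr ?ler_piMl ?cos_le1.
Qed.

Section Geodesic.
Variables (R : realType) (n : nat) (x y : 'cV[R]_n).
Let theta := acos (dotprod x y).

(** A geodesic is a combination of cos (t theta) and sin (t theta) with
constant vector coefficients; any such function of t satisfies this three
point relation, by the formula for the sine of a difference. *)
Lemma geodesic_interpolation (s p t : R) :
  sin ((t - s) * theta) *: geodesic x y p =
  sin ((t - p) * theta) *: geodesic x y s
  + sin ((p - s) * theta) *: geodesic x y t.
Proof.
rewrite /geodesic -/theta !mulrBl !sinB; apply/colP => i; rewrite !mxE.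
by ring.
Qed.

Lemma geodesic0 : geodesic x y 0 = x.
Proof. by rewrite /geodesic mul0r cos0 sin0 mul0r scale1r scale0r addr0. Qed.

Hypotheses (hx : sphere R n x) (hy : sphere R n y).
Hypotheses (hyx : y <> x) (hyNx : y <> - x).

Lemma geodesic_angle : 0 < theta < pi.
Proof.
have /andP[h1 h2] := sphere_dotprod_lt1 hx hy hyx hyNx.
by rewrite acos_gt0 ?acos_ltpi ?h1 ?h2 ?ltW.
Qed.

Let sqrt_gt0 : 0 < Num.sqrt (1 - dotprod x y ^+ 2).
Proof.
have /andP[h1 h2] := sphere_dotprod_lt1 hx hy hyx hyNx.
by rewrite sqrtr_gt0; nra.
Qed.

Lemma geodesic1 : geodesic x y 1 = y.
Proof.
have /andP[h1 h2] := sphere_dotprod_lt1 hx hy hyx hyNx.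
rewrite /geodesic mul1r sin_acos ?acosK ?in_itv/= ?ltW ?h1//.
by rewrite divff ?gt_eqF// scale1r addrC subrK.
Qed.

Lemma geodesic_sphere t : sphere R n (geodesic x y t).
Proof.
have /andP[h1 h2] := sphere_dotprod_lt1 hx hy hyx hyNx.
apply/sphere_dotprod; move: hx hy => /sphere_dotprod hx1 /sphere_dotprod hy1.
rewrite /geodesic -/theta !dotprodE hx1 hy1 (dotprodC y x).
set c := dotprod x y; set r := Num.sqrt _.
have hr : r ^+ 2 = 1 - c ^+ 2 by rewrite sqr_sqrtr// /c; nra.
transitivity (cos (t * theta) ^+ 2
  + sin (t * theta) ^+ 2 / r ^+ 2 * (1 - c ^+ 2)).
  by field; rewrite gt_eqF//; exact: sqrt_gt0.
rewrite -hr divfK ?cos2Dsin2// expf_neq0// gt_eqF//; exact: sqrt_gt0.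
Qed.

(** The coefficients of the three point relation are nonnegative for
s <= p <= t, and after division by sin ((t - s) theta) their sum is at least
1.  Nonnegativity of the product along the arc is essential: it lets a sum of
coefficients larger than 1 only increase the lower bound. *)
Lemma geodesic_dotprod_min (v : 'cV[R]_n) (s p t : R) :
  (forall u, 0 <= u <= 1 -> 0 <= dotprod v (geodesic x y u)) ->
  0 <= s -> s <= p -> p <= t -> t <= 1 ->
  Num.min (dotprod v (geodesic x y s)) (dotprod v (geodesic x y t))
  <= dotprod v (geodesic x y p).
Proof.
move=> hv s0 sp pt t1.
have [pis|] := eqVneq p s; first by rewrite pis ge_min lexx.
rewrite neq_lt => /orP[|ltsp]; first by rewrite ltNge sp.
have /andP[th0 thpi] := geodesic_angle.
have thE a : 0 <= a -> a <= 1 -> 0 <= a * theta <= pi.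
  by move=> a0 a1; apply/andP; split; nra.
have hS : 0 < sin ((t - s) * theta).
  by apply: sin_gt0_pi; apply/andP; split; nra.
have hA : 0 <= sin ((t - p) * theta) by apply: sin_ge0_pi; apply: thE; lra.
have hB : 0 <= sin ((p - s) * theta) by apply: sin_ge0_pi; apply: thE; lra.
have hAB : sin ((t - s) * theta) <=
    sin ((t - p) * theta) + sin ((p - s) * theta).
  have -> : (t - s) * theta = (t - p) * theta + (p - s) * theta by ring.
  by apply: sinD_le; apply: thE; lra.
have := congr1 (dotprod v) (geodesic_interpolation s p t).
rewrite dotprodDr 3!dotprodZr => heq.
rewrite -(ler_pM2l hS) heq.
have g0 : 0 <=
    Num.min (dotprod v (geodesic x y s)) (dotprod v (geodesic x y t)).
  by rewrite le_min !hv//; apply/andP; split; lra.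
apply: (le_trans (ler_wpM2r g0 hAB)); rewrite mulrDl.
by apply: lerD; apply: ler_wpM2l; rewrite // ge_min lexx ?orbT.
Qed.

End Geodesic.

(** * The Lorentz cone and the sufficient condition *)

Section LorentzCone.
Variables (R : realType) (n : nat).
Implicit Types x y v : 'cV[R]_n.+1.

Lemma dotprod_recl x y : dotprod x y = x ord0 0 * y ord0 0 +
  \sum_(i < n) x (lift ord0 i) 0 * y (lift ord0 i) 0.
Proof. exact: big_ord_recl. Qed.

(** One half of the self-duality of the cone: by the Cauchy-Schwarz inequality
the scalar product of the tails is at least minus the product of their norms,
hence minus the product of the heads. *)
Lemma lorentz_dotprod_ge0 x y : lorentz R n x -> lorentz R n y ->
  0 <= dotprod x y.
Proof.
rewrite /lorentz /= => hx hy; rewrite dotprod_recl.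
pose tl (z : 'cV[R]_n.+1) : 'cV[R]_n := \col_i z (lift ord0 i) 0.
have tlE (z w : 'cV[R]_n.+1) :
    \sum_(i < n) z (lift ord0 i) 0 * w (lift ord0 i) 0 =
    dotprod (tl z) (tl w) by apply: eq_bigr => i _; rewrite !mxE.
have tlE2 (z : 'cV[R]_n.+1) :
    \sum_(i < n) z (lift ord0 i) 0 ^+ 2 = dotprod (tl z) (tl z).
  by rewrite -tlE; apply: eq_bigr => i _; rewrite expr2.
rewrite tlE; rewrite !tlE2 in hx hy.
rewrite -[X in _ <= _ + X]opprK subr_ge0.
apply: le_trans (ler_norm _) _; rewrite normrN -sqrtr_sqr.
apply: le_trans (ler_wsqrtr (cauchy_schwarz _ _)) _.
by rewrite sqrtrM ?dotprod_ge0// ler_pM ?sqrtr_ge0.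
Qed.

(** The difference between the head and the norm of the tail is continuous. *)
Lemma lorentz_interior x :
  Num.sqrt (\sum_(i < n) x (lift ord0 i) 0 ^+ 2) < x ord0 0 ->
  interior (lorentz R n) x.
Proof.
move=> hx.
have hc i : continuous (fun y : 'cV[R]_n.+1 => y i 0)
  by exact: coord_continuous.
have hsum : {for x, continuous (fun y : 'cV[R]_n.+1 =>
    y ord0 0 - Num.sqrt (\sum_(i < n) y (lift ord0 i) 0 ^+ 2))}.
  apply: continuousB; first exact: hc.
  apply: continuous_comp; last exact: sqrt_continuous.
  move: x {hx}; apply: continuous_big => [|i _ y]; first exact: add_continuous.
  apply: (@continuous_comp _ _ _ (fun y : 'cV[R]_n.+1 => y (lift ord0 i) 0)
    (fun a : R => a ^+ 2)); [exact: hc|exact: exprn_continuous].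
rewrite -subr_gt0 in hx.
have /(_ (nbhs_filter (x : 'cV[R]_n.+1))) hpos := cvgr_gt _ hsum _ hx.
rewrite /interior /=; apply: (@filterS _ _ (nbhs_filter x) _ _ _ hpos) => y /=.
by rewrite subr_gt0 => /ltW.
Qed.

End LorentzCone.

(** At unit vectors where the product with v is nonnegative, q_A decreases when
this product increases, so a lower bound by a minimum for the product becomes
an upper bound by a maximum for q_A. *)
Lemma quasiconvex_of_lorentz_eigenvector (R : realType) (n : nat)
    (A : 'M[R]_n.+1) (lam mu : R) (v : 'cV[R]_n.+1) :
  lam <= mu ->  v <> 0 ->
  (forall x, dotprod v v * qform A x =
    mu * dotprod v v * dotprod x x - (mu - lam) * dotprod v x ^+ 2) ->
  lorentz R n v ->
  spherically_quasiconvex (lorentz_sphere R n) (qform A).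
Proof.
move=> hlt v0 hq hv x y hx hy hyx hyNx hC.
have hvv := dotprod_gt0 v0.
have hg u : 0 <= u <= 1 -> 0 <= dotprod v (geodesic x y u).
  move=> hu; apply: lorentz_dotprod_ge0 => //.
  have [_ h] : lorentz_sphere R n (geodesic x y u).
    by apply: hC; exists u; rewrite //= in_itv.
  exact: interior_subset h.
have hmin s p t : 0 <= s -> s <= p -> p <= t -> t <= 1 ->
    qform A (geodesic x y p) <=
    Num.max (qform A (geodesic x y s)) (qform A (geodesic x y t)).
  move=> s0 sp pt t1.
  have := geodesic_dotprod_min hx hy hyx hyNx hg s0 sp pt t1.
  have hle a b : 0 <= a <= 1 -> 0 <= b <= 1 ->
      dotprod v (geodesic x y a) <= dotprod v (geodesic x y b) ->
      qform A (geodesic x y b) <= qform A (geodesic x y a).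
    move=> ha hb hab; rewrite -(ler_pM2l hvv) !hq.
    have /sphere_dotprod -> := geodesic_sphere hx hy hyx hyNx a.
    have /sphere_dotprod -> := geodesic_sphere hx hy hyx hyNx b.
    by rewrite lerB// ler_wpM2l ?subr_ge0// ler_sqr ?nnegrE ?hg.
  rewrite ge_min le_max => /orP[h|h]; apply/orP; [left|right];
    by apply: hle h; apply/andP; split; lra.
move=> s t p; rewrite /= !in_itv /= => /andP[s0 s1] /andP[t0 t1] /andP[p0 p1].
case: (leP s t) => st; last rewrite maxC; apply: hmin => //; nra.
Qed.

(** * Plane sections of the cone and the necessary condition *)

Section LorentzPlane.
Variables (R : realType) (n : nat) (v : 'cV[R]_n.+1).
Let s : R := Num.sqrt (\sum_(i < n) v (lift ord0 i) 0 ^+ 2).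

(** Coordinates on the plane spanned by the axis of the cone and v.  The axis
vector is scaled by the norm s of the tail of v, so that the open cone becomes
|b| < a. *)
Definition lorentz_plane (a b : R) : 'cV[R]_n.+1 :=
  \col_i (if i == ord0 then a * s else b * v i 0).

Lemma lorentz_planeD a b c d :
  lorentz_plane a b + lorentz_plane c d = lorentz_plane (a + c) (b + d).
Proof. by apply/colP => i; rewrite !mxE; case: eqP => _; rewrite mulrDl. Qed.

Lemma lorentz_planeZ k a b :
  k *: lorentz_plane a b = lorentz_plane (k * a) (k * b).
Proof. by apply/colP => i; rewrite !mxE; case: eqP => _; rewrite mulrA. Qed.

Hypothesis hv : `|v ord0 0| < s.

Let s_gt0 : 0 < s. Proof. exact: le_lt_trans (normr_ge0 _) hv. Qed.

Lemma lorentz_plane_interior a b : `|b| < a ->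
  interior (lorentz R n) (lorentz_plane a b).
Proof.
move=> hab; apply: lorentz_interior.
have -> : \sum_(i < n) lorentz_plane a b (lift ord0 i) 0 ^+ 2 =
    b ^+ 2 * \sum_(i < n) v (lift ord0 i) 0 ^+ 2.
  by rewrite mulr_sumr; apply: eq_bigr => i _; rewrite mxE exprMn.
by rewrite sqrtrM ?sqr_ge0// sqrtr_sqr mxE eqxx ltr_pM2r.
Qed.

Lemma dotprod_lorentz_plane a b :
  dotprod v (lorentz_plane a b) = s * (a * v ord0 0 + b * s).
Proof.
have hs : s ^+ 2 = \sum_(i < n) v (lift ord0 i) 0 ^+ 2.
  by apply: sqr_sqrtr; apply: sumr_ge0 => i _; exact: sqr_ge0.
rewrite dotprod_recl mxE eqxx.
have -> : \sum_(i < n) v (lift ord0 i) 0 * lorentz_plane a b (lift ord0 i) 0 =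
    b * s ^+ 2.
  rewrite hs mulr_sumr; apply: eq_bigr => i _.
  by rewrite mxE /= mulrCA expr2.
by ring.
Qed.

End LorentzPlane.

Lemma dotprod_lorentz_plane2 (R : realType) (n : nat) (v : 'cV[R]_n.+1) a b :
  dotprod (lorentz_plane v a b) (lorentz_plane v a b) =
  (a ^+ 2 + b ^+ 2) * \sum_(i < n) v (lift ord0 i) 0 ^+ 2.
Proof.
rewrite dotprod_recl !mxE eqxx mulrDl; congr (_ + _).
  by rewrite -expr2 exprMn sqr_sqrtr//; apply: sumr_ge0 => i _; exact: sqr_ge0.
by rewrite mulr_sumr; apply: eq_bigr => i _; rewrite !mxE /= -expr2 exprMn.
Qed.

(** On [0, 1] the geodesic is a nonzero combination of its endpoints with
nonnegative coefficients, and |b| < a defines a convex cone. *)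
Lemma geodesic_lorentz_plane (R : realType) (n : nat) (v x y : 'cV[R]_n.+1)
    (a b c d : R) :
  `|v ord0 0| < Num.sqrt (\sum_(i < n) v (lift ord0 i) 0 ^+ 2) ->
  x = lorentz_plane v a b -> y = lorentz_plane v c d ->
  `|b| < a -> `|d| < c ->
  sphere R n.+1 x -> sphere R n.+1 y -> y <> x -> y <> - x ->
  forall t, 0 <= t <= 1 -> lorentz_sphere R n (geodesic x y t).
Proof.
move=> hv ex ey hab hcd hx hy hyx hyNx t /andP[t0 t1].
split; first exact: geodesic_sphere.
have /andP[] := geodesic_angle hx hy hyx hyNx.
set th := acos _ => th0 thpi.
have hS : 0 < sin th by apply: sin_gt0_pi; rewrite th0.
have thE u : 0 <= u -> u <= 1 -> 0 <= u * th <= pi.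
  by move=> u0 u1; apply/andP; split; nra.
have h1t : 0 <= (1 - t) * th <= pi by apply: thE; lra.
have ht : 0 <= t * th <= pi by apply: thE; lra.
have hA := sin_ge0_pi h1t.
have hB := sin_ge0_pi ht.
have hAB : sin th <= sin ((1 - t) * th) + sin (t * th).
  have {1}-> : th = (1 - t) * th + t * th by ring.
  exact: sinD_le.
have := geodesic_interpolation x y 0 t 1.
rewrite geodesic0 geodesic1// !subr0 mul1r -/th.
move: (geodesic x y t) => g.
set A := sin ((1 - t) * th) in hA hAB *; set B := sin (t * th) in hB hAB *.
rewrite ex ey !lorentz_planeZ lorentz_planeD => /(congr1 ( *:%R (sin th)^-1)).
rewrite scalerA mulVf ?gt_eqF// scale1r lorentz_planeZ => ->.
apply: lorentz_plane_interior => //.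
rewrite normrM gtr0_norm ?invr_gt0// ltr_pM2l ?invr_gt0//.
apply: le_lt_trans (ler_normD _ _) _.
rewrite !normrM (ger0_norm hA) (ger0_norm hB).
have hB' : B * `|d| <= B * c by apply: ler_wpM2l (ltW hcd).
have [A0|A0] := eqVneq A 0; last first.
  have : A * `|b| < A * a by rewrite ltr_pM2l// lt0r A0.
  by lra.
by rewrite A0 !mul0r !add0r ltr_pM2l//; lra.
Qed.

(** In the coordinates of the plane, v is (k, 1) with |k| < 1 and (1, - k) is
orthogonal to it.  The endpoints are normalizations of X = (1, - k) + e (k, 1)
and Y = (1, - k) - e (k, 1), which have the same norm, so that the midpoint of
the geodesic is proportional to (1, - k). *)
Lemma not_quasiconvex_of_outside_cone (R : realType) (n : nat)
    (A : 'M[R]_n.+1) (lam mu : R) (v : 'cV[R]_n.+1) :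
  lam < mu ->
  (forall x, dotprod v v * qform A x =
    mu * dotprod v v * dotprod x x - (mu - lam) * dotprod v x ^+ 2) ->
  `|v ord0 0| < Num.sqrt (\sum_(i < n) v (lift ord0 i) 0 ^+ 2) ->
  ~ spherically_quasiconvex (lorentz_sphere R n) (qform A).
Proof.
move=> hlt hq hv hqc.
set s := Num.sqrt _ in hv.
have s0 : 0 < s by exact: le_lt_trans (normr_ge0 _) hv.
pose k := v ord0 0 / s.
have vk : v ord0 0 = k * s by rewrite divfK ?gt_eqF.
have /andP[k1 k2] : -1 < k < 1.
  by rewrite -ltr_norml normrM normfV [`|s|]gtr0_norm// ltr_pdivrMr// mul1r.
have v0 : v <> 0.
  move=> v0; move: s0; rewrite /s v0 big1 ?sqrtr0 ?ltxx// => i _.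
  by rewrite mxE expr0n.
have hvv := dotprod_gt0 v0.
(* The two upper bounds on e say that X and Y are in the open cone. *)
have [e [e0 e1 e2]] :
    exists e : R, [/\ 0 < e, e * (1 - k) < 1 + k & e * (1 + k) < 1 - k].
  pose e := (1 - k ^+ 2) / 4; exists e.
  have -> : e * (1 - k) = (1 + k) * ((1 - k) ^+ 2 / 4) by rewrite /e; field.
  have -> : e * (1 + k) = (1 - k) * ((1 + k) ^+ 2 / 4) by rewrite /e; field.
  by split; rewrite ?gtr_pMr; rewrite /e; nra.
pose X := lorentz_plane v (1 + e * k) (e - k).
pose Y := lorentz_plane v (1 - e * k) (- e - k).
have e3 : 0 < e * (1 - k) by rewrite mulr_gt0//; lra.
have e4 : 0 < e * (1 + k) by rewrite mulr_gt0//; lra.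
have bX : `|e - k| < 1 + e * k by rewrite ltr_norml; apply/andP; split; lra.
have bY : `|- e - k| < 1 - e * k by rewrite ltr_norml; apply/andP; split; lra.
have vX : dotprod v X = s ^+ 2 * e * (1 + k ^+ 2).
  by rewrite dotprod_lorentz_plane -/s vk; ring.
have vY : dotprod v Y = - dotprod v X.
  by rewrite vX dotprod_lorentz_plane -/s vk; ring.
have vX0 : 0 < dotprod v X.
  have k3 : 0 < 1 + k ^+ 2 by rewrite ltr_wpDr ?sqr_ge0.
  by rewrite vX !mulr_gt0// exprn_gt0.
have hXY : dotprod Y Y = dotprod X X.
  by rewrite !dotprod_lorentz_plane2; congr (_ * _); ring.
have X0 : X <> 0.
  by move=> X0; move: vX0; rewrite X0 dotprodr0 ltxx.
pose N := (norm2 X)^-1.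
have NE : N ^+ 2 * dotprod X X = 1.
  rewrite exprVn sqr_sqrtr ?dotprod_ge0// mulVf//.
  by rewrite gt_eqF// dotprod_gt0.
have N0 : 0 < N by rewrite invr_gt0 sqrtr_gt0 dotprod_gt0.
pose x := N *: X; pose y := N *: Y.
have hx : sphere R n.+1 x.
  by apply/sphere_dotprod; rewrite !dotprodE mulrA -expr2.
have hy : sphere R n.+1 y.
  by apply/sphere_dotprod; rewrite !dotprodE mulrA -expr2 hXY.
have vx : 0 < dotprod v x by rewrite dotprodZr mulr_gt0.
have vy : dotprod v y = - dotprod v x by rewrite !dotprodZr vY mulrN.
have hyx : y <> x by move=> yx; move: vx vy; rewrite yx; lra.
have hyNx : y <> - x.
  (* Both vectors have a positive coordinate along the axis of the cone. *)
  move=> /(congr1 (fun u : 'cV[R]_n.+1 => u ord0 0)).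
  rewrite !mxE eqxx -/s => h.
  have : N * s * 2 = 0.
    transitivity (N * ((1 - e * k) * s) + N * ((1 + e * k) * s)); first by ring.
    by rewrite h addNr.
  by apply/eqP; rewrite gt_eqF// !mulr_gt0.
have hC := geodesic_lorentz_plane hv (lorentz_planeZ _ _ _ _)
  (lorentz_planeZ _ _ _ _) _ _ hx hy hyx hyNx.
have h01 u : 0 <= u <= 1 -> (`[0, 1]%classic : set R) u by rewrite /= in_itv.
have hqc' := hqc x y hx hy hyx hyNx.
have {hqc'} : qform A (geodesic x y (1 / 2)) <= Num.max (qform A x) (qform A y).
  have -> : 1 / 2 = (1 - 1 / 2) * 0 + 1 / 2 * 1 :> R by ring.
  rewrite -[in leRHS](geodesic0 x y)
    -[in X in Num.max _ X](geodesic1 hx hy hyx hyNx).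
  apply: hqc'.
  - move=> _ [t /= ht <-]; apply: hC => //.
    + by rewrite !normrM gtr0_norm// ltr_pM2l.
    + by rewrite !normrM gtr0_norm// ltr_pM2l.
  - by apply: h01; lra.
  - by apply: h01; lra.
  - by lra.
have vmid : dotprod v (geodesic x y (1 / 2)) = 0.
  have := congr1 (dotprod v) (geodesic_interpolation x y 0 (1 / 2) 1).
  rewrite dotprodDr 3!dotprodZr geodesic0 geodesic1// vy mulrN.
  have -> : (1 - 1 / 2 : R) = 1 / 2 - 0 by field.
  rewrite subrr => /eqP; rewrite mulf_eq0 => /orP[|/eqP//].
  by rewrite subr0 mul1r gt_eqF// sin_gt0_pi// geodesic_angle.
rewrite le_max => h.
have hlt2 u : sphere R n.+1 u -> dotprod v u ^+ 2 = dotprod v x ^+ 2 ->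
    qform A u < qform A (geodesic x y (1 / 2)).
  move=> /sphere_dotprod hu1 hu2; rewrite -(ltr_pM2l hvv) !hq hu1 hu2 vmid.
  have /sphere_dotprod -> := geodesic_sphere hx hy hyx hyNx (1 / 2).
  by rewrite expr0n mulr0 subr0 ltrBlDr ltrDl mulr_gt0 ?subr_gt0 ?exprn_gt0.
have h1 := hlt2 x hx erefl; have h2 := hlt2 y hy.
rewrite vy sqrrN in h2; have {}h2 := h2 erefl.
by move: h; rewrite !leNgt h1 h2.
Qed.

(* The dimension is n.+1 >= 3.  The library's eigenvalue refers to row
   eigenvectors, which makes no difference as A is symmetric. *)
Theorem theorem5p5p2 (R : realType) (n : nat) (hn : (3 <= n.+1)%N)
    (A : 'M[R]_n.+1) (hA : A^T = A) (lam mu : R) (hlt : lam < mu)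
    (heig : forall a : R, eigenvalue A a <-> a = lam \/ a = mu)
    (hmult : mup lam (char_poly A) = 1%N) :
  spherically_quasiconvex (lorentz_sphere R n) (qform A) <->
  exists v : 'cV[R]_n.+1, lorentz R n v /\ is_eigenvector A lam v.
Proof.
have hq v x : A *m v = lam *: v -> dotprod v v * qform A x =
    mu * dotprod v v * dotprod x x - (mu - lam) * dotprod v x ^+ 2.
  by apply: qform_simple_eigenvalue => // a /heig.
split=> [hqc|[v [hv [v0 Av]]]]; last first.
  apply: (quasiconvex_of_lorentz_eigenvector (ltW hlt) v0 _ hv) => x.
  exact: hq.
have /eigenvalueP[u uA u0] : eigenvalue A lam by apply/heig; left.
have Av : A *m u^T = lam *: u^T by rewrite -[in LHS]hA -trmx_mul uA linearZ.
have v0 : u^T <> 0.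
  by move=> h; move/eqP: u0; apply; apply: trmx_inj; rewrite h trmx0.
have [hlor|] := leP (Num.sqrt (\sum_(i < n) u^T (lift ord0 i) 0 ^+ 2))
  `|u^T ord0 0|; last first.
  move=> hout; have hqu x := hq _ x Av.
  by have := not_quasiconvex_of_outside_cone hlt hqu hout hqc.
have [upos|uneg] := leP 0 (u^T ord0 0).
  by exists u^T; split; rewrite // /lorentz /= -(ger0_norm upos).
exists (- u^T); split.
  rewrite /lorentz /= [X in _ <= X]mxE -(ltr0_norm uneg).
  by under eq_bigr do rewrite mxE sqrrN.
split; last by rewrite mulmxN Av scalerN.
by move=> /(congr1 -%R); rewrite opprK oppr0.
Qed.
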